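(* Let $f$ be a smooth real function and let $u(x,t)$ be a smooth solution of the general nonlinear advection equation $$\partial_t u=f(u)\,\partial_x u .$$ For $j\ge0$ let $u_j(u)=\int f^j(u)\,du$ (with $u_0(u)=u$) and write $u_j(x,t)=u_j(u(x,t))$. Then $\partial_t^j u=\partial_x^j u_j$ for all $j\ge1$, so that the solution has the Taylor expansion in $\Delta t$ $$u(x,\Delta t)=u(x,0)+\Delta t\,\partial_x u_1(x,0)+\frac{\Delta t^2}{2!}\partial_x^2u_2(x,0)+\frac{\Delta t^3}{3!}\partial_x^3u_3(x,0)+\cdots .$$ Moreover, for every $n\ge1$ and every set $\{k_1,\dots,k_N\}$ of $N=n+1$ (distinct) integers, with $\nu=\Delta t/\Delta x$, the finite-difference scheme $$u(x,\Delta t)=\sum_{j=0}^{n}\sum_{i=1}^{N}c_{ji}\,u_j(x+k_i\Delta x,0),\qquad c_{ji}=\frac{\nu^j}{j!}L_i^{(j)}(0),$$ is an $n$th-order time-marching scheme for this equation: its coefficients satisfy, for $0\le j,\ell\le n$, $$\sum_{i=1}^N c_{ji}\,k_i^{\ell}=\begin{cases}\nu^j,&\ell=j,\\ 0,&\ell\neq j,\end{cases}$$ so that its right-hand side matches the Taylor expansion $u(x,\Delta t)=\sum_{j\ge0}\frac{\Delta t^j}{j!}\partial_x^ju_j(x,0)$ of the solution through the terms of order $n$.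
   Context: $\int f^j(u)\,du$ denotes any fixed antiderivative of the $j$th power $f(u)^j$ with respect to $u$. $L_i(x)=\prod_{j\ne i}\frac{x-k_j}{k_i-k_j}$, $1\le i\le N$, are the Lagrange polynomials of degree $N-1=n$ on the points $k_1,\dots,k_N$, and $L_i^{(j)}(0)$ is the $j$th derivative at $0$ ($L_i^{(0)}=L_i$). $\Delta t,\Delta x>0$ are the time step and grid spacing; $0^0=1$. ''Matches through the terms of order $n$'' means that, on Taylor expanding each $u_j(x+k_i\Delta x,0)$ in $\Delta x$ through order $\Delta x^n$, the right-hand side of the scheme becomes $\sum_{j=0}^n\frac{\Delta t^j}{j!}\partial_x^ju_j(x,0)$. The expansion of $u(x,\Delta t)$ is understood as a formal Taylor expansion at $t=0$. *)

(* Defs.v *)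
From Stdlib Require Import Reals ZArith Arith.
From Coquelicot Require Import Coquelicot.
Open Scope R_scope.

Definition smooth (f : R -> R) : Prop :=
  forall (m : nat) (v : R), ex_derive_n f m v.

(* C^m on a set D, meant for open D: all mixed partial derivatives of order
   at most m, taken in any order, exist and are continuous at each point of D.
   [Derive] is total, but for open D only its values on D matter here. *)
Fixpoint Cm_on (m : nat) (D : R * R -> Prop) (v : R -> R -> R) : Prop :=
  (forall x t, D (x, t) -> continuity_2d_pt v x t) /\
  match m with
  | O => True
  | S m' =>
      (forall x t, D (x, t) ->
         ex_derive (fun y => v y t) x /\ ex_derive (fun s => v x s) t) /\
      Cm_on m' D (fun x t => Derive (fun y => v y t) x) /\
      Cm_on m' D (fun x t => Derive (fun s => v x s) t)
  end.

Definition smooth_on (D : R * R -> Prop) (v : R -> R -> R) : Prop :=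
  forall m : nat, Cm_on m D v.

Definition advection_solution_on
    (D : R * R -> Prop) (f : R -> R) (u : R -> R -> R) : Prop :=
  forall x t, D (x, t) ->
    Derive (fun s => u x s) t = f (u x t) * Derive (fun y => u y t) x.

(* [U j] is a fixed choice of antiderivative of the j-th power of f; for j = 0
   the constant of integration is fixed by u_0(u) = u. *)
Definition antiderivatives_of_powers (f : R -> R) (U : nat -> R -> R) : Prop :=
  (forall v, U 0%nat v = v) /\
  (forall (j : nat) (v : R), is_derive (U j) v (f v ^ j)).

(* Coefficient of h^m in the formal Taylor series of g (a + h). *)
Definition taylor_coef (g : R -> R) (a : R) (m : nat) : R :=
  Derive_n g m a / INR (fact m).

(* Taylor polynomial of degree n of g at 0, evaluated at h. *)
Definition taylor_poly (n : nat) (g : R -> R) (h : R) : R :=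
  sum_f_R0 (fun l => taylor_coef g 0 l * h ^ l) n.

(* The N = n + 1 nodes are k 0, ..., k n: indices are shifted down by one, and
   the values of k beyond n are irrelevant. *)
Definition distinct_nodes (n : nat) (k : nat -> Z) : Prop :=
  forall i j, (i <= n)%nat -> (j <= n)%nat -> k i = k j -> i = j.

Definition lagrange (n : nat) (k : nat -> Z) (i : nat) (x : R) : R :=
  prod_f_R0
    (fun j => if Nat.eqb j i then 1
              else (x - IZR (k j)) / (IZR (k i) - IZR (k j))) n.

Definition scheme_coef (n : nat) (k : nat -> Z) (nu : R) (j i : nat) : R :=
  nu ^ j / INR (fact j) * Derive_n (lagrange n k i) j 0.

(* Right-hand side of the scheme as a function of the data w j i that stand for
   u_j(x + k_i dx, 0): either these samples themselves or their expansions. *)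
Definition scheme_rhs (n : nat) (k : nat -> Z) (nu : R)
    (w : nat -> nat -> R) : R :=
  sum_f_R0 (fun j => sum_f_R0 (fun i => scheme_coef n k nu j i * w j i) n) n.

(* Main.v *)
(** With [w = U j o u], the chain rule and the equation give
    [dt w = f(u)^j dt u = f(u)^(j+1) dx u = dx (U (j+1) o u)].  Since [dt]
    commutes with [dx^j] (Schwarz), induction on [j] yields
    [dt^(j+1) u = dt dx^j (U j o u) = dx^j dt (U j o u)
    = dx^(j+1) (U (j+1) o u)].

    The moment conditions are the [j]-th derivatives at [0] of the identity
    [sum_i k_i^l L_i(x) = x^l] for [l <= n], whose two sides are polynomials of
    degree at most [n] agreeing at [n + 1] points.  Expanding each
    [U j (u (x + k_i h) 0)] in [h], these conditions keep exactly the diagonal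
    terms [l = j]. *)

Require Import Defs.
From Stdlib Require Import Reals ZArith Arith Lra Lia.
From Coquelicot Require Import Coquelicot.
Open Scope R_scope.

(** * Smooth functions of two variables *)

Lemma locally_slice_x (D : R * R -> Prop) (x t : R) :
  open D -> D (x, t) -> locally x (fun y => D (y, t)).
Proof.
  intros HD H.
  apply (locally_2d_1d_const_y (fun y s => D (y, s)) x t).
  apply locally_2d_locally.
  apply (filter_imp D); [intros [y s]; trivial | exact (HD _ H)].
Qed.

Lemma locally_slice_t (D : R * R -> Prop) (x t : R) :
  open D -> D (x, t) -> locally t (fun s => D (x, s)).
Proof.
  intros HD H.
  apply (locally_2d_1d_const_x (fun y s => D (y, s)) x t).
  apply locally_2d_locally.
  apply (filter_imp D); [intros [y s]; trivial | exact (HD _ H)].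
Qed.

Lemma locally_2d_open (D : R * R -> Prop) (x t : R) :
  open D -> D (x, t) -> locally_2d (fun y s => D (y, s)) x t.
Proof.
  intros HD H.
  apply locally_2d_locally.
  apply (filter_imp D); [intros [y s]; trivial | exact (HD _ H)].
Qed.

(** Openness gives each point of [D] a neighbourhood inside [D], in the plane and along both slices,
    and continuity and [Derive] depend on nothing else. Derivative formulas valid only on [D] can
    thus replace [Derive] in the recursive clauses of [Cm_on]. *)
Lemma Cm_on_ext (m : nat) (D : R * R -> Prop) (v w : R -> R -> R) :
  open D -> (forall x t, D (x, t) -> v x t = w x t) ->
  Cm_on m D v -> Cm_on m D w.
Proof.
  intros HD; revert v w; induction m as [|m IH]; intros v w E [Hc Hd].
  all: split;
    [intros x t H; apply continuity_2d_pt_ext_loc with v; [|now apply Hc];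
     apply locally_2d_impl with (2 := locally_2d_open D x t HD H);
     apply locally_2d_forall; intros; now apply E|].
  { trivial. }
  destruct Hd as [He [Hx Ht]].
  split; [intros x t H; split|split].
  - apply (@ex_derive_ext_loc R_AbsRing R_NormedModule (fun y => v y t));
      [|exact (proj1 (He x t H))].
    apply (filter_imp (fun y => D (y, t))); [intros; now apply E|].
    now apply locally_slice_x.
  - apply (@ex_derive_ext_loc R_AbsRing R_NormedModule (fun s => v x s));
      [|exact (proj2 (He x t H))].
    apply (filter_imp (fun s => D (x, s))); [intros; now apply E|].
    now apply locally_slice_t.
  - apply IH with (2 := Hx); intros x t H; apply Derive_ext_loc.
    apply (filter_imp (fun y => D (y, t))); [intros; now apply E|].
    now apply locally_slice_x.
  - apply IH with (2 := Ht); intros x t H; apply Derive_ext_loc.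
    apply (filter_imp (fun s => D (x, s))); [intros; now apply E|].
    now apply locally_slice_t.
Qed.

Lemma Cm_on_S (m : nat) (D : R * R -> Prop) (v : R -> R -> R) :
  Cm_on (S m) D v -> Cm_on m D v.
Proof.
  revert v; induction m as [|m IH]; intros v [Hc [He [Hx Ht]]].
  - now split.
  - split; [exact Hc|]; split; [exact He|]; split; now apply IH.
Qed.

Lemma Cm_on_const (m : nat) (D : R * R -> Prop) (c : R) :
  open D -> Cm_on m D (fun _ _ => c).
Proof.
  intros HD; revert c; induction m as [|m IH]; intros c.
  all: split; [intros; apply continuity_2d_pt_const|].
  { trivial. }
  split; [split; apply ex_derive_const|split].
  all: apply Cm_on_ext with (fun _ _ => 0); trivial.
  all: intros; now rewrite Derive_const.
Qed.

Lemma Cm_on_plus (m : nat) (D : R * R -> Prop) (v w : R -> R -> R) :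
  open D -> Cm_on m D v -> Cm_on m D w ->
  Cm_on m D (fun x t => v x t + w x t).
Proof.
  intros HD; revert v w; induction m as [|m IH]; intros v w [Hvc Hv] [Hwc Hw].
  all: split;
    [intros; apply continuity_2d_pt_plus; [now apply Hvc|now apply Hwc]|].
  { trivial. }
  destruct Hv as [Hve [Hvx Hvt]], Hw as [Hwe [Hwx Hwt]].
  split; [intros x t H; split|split].
  - apply @ex_derive_plus;
      [exact (proj1 (Hve x t H))|exact (proj1 (Hwe x t H))].
  - apply @ex_derive_plus;
      [exact (proj2 (Hve x t H))|exact (proj2 (Hwe x t H))].
  - apply Cm_on_ext with (3 := IH _ _ Hvx Hwx); trivial.
    intros x t H; rewrite Derive_plus; trivial;
      [exact (proj1 (Hve x t H))|exact (proj1 (Hwe x t H))].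
  - apply Cm_on_ext with (3 := IH _ _ Hvt Hwt); trivial.
    intros x t H; rewrite Derive_plus; trivial;
      [exact (proj2 (Hve x t H))|exact (proj2 (Hwe x t H))].
Qed.

(** By the Leibniz rule a partial derivative is a sum of two products. The undifferentiated factor
    in each is C^(m+1) and is lowered to C^m, so that the induction hypothesis covers both
    products. *)
Lemma Cm_on_mult (m : nat) (D : R * R -> Prop) (v w : R -> R -> R) :
  open D -> Cm_on m D v -> Cm_on m D w ->
  Cm_on m D (fun x t => v x t * w x t).
Proof.
  intros HD; revert v w; induction m as [|m IH]; intros v w Hv Hw.
  - split; [|trivial]; intros x t H.
    apply continuity_2d_pt_mult; [now apply Hv|now apply Hw].
  - pose proof (Cm_on_S _ _ _ Hv) as Hv0; pose proof (Cm_on_S _ _ _ Hw) as Hw0.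
    destruct Hv as [Hvc [Hve [Hvx Hvt]]], Hw as [Hwc [Hwe [Hwx Hwt]]].
    split;
      [intros; apply continuity_2d_pt_mult; [now apply Hvc|now apply Hwc]|].
    split; [intros x t H; split|split].
    + apply ex_derive_mult;
      [exact (proj1 (Hve x t H))|exact (proj1 (Hwe x t H))].
    + apply ex_derive_mult;
      [exact (proj2 (Hve x t H))|exact (proj2 (Hwe x t H))].
    + apply Cm_on_ext with
        (3 := Cm_on_plus _ _ _ _ HD (IH _ _ Hvx Hw0) (IH _ _ Hv0 Hwx)); trivial.
      intros x t H; rewrite Derive_mult; trivial;
      [exact (proj1 (Hve x t H))|exact (proj1 (Hwe x t H))].
    + apply Cm_on_ext with
        (3 := Cm_on_plus _ _ _ _ HD (IH _ _ Hvt Hw0) (IH _ _ Hv0 Hwt)); trivial.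
      intros x t H; rewrite Derive_mult; trivial;
      [exact (proj2 (Hve x t H))|exact (proj2 (Hwe x t H))].
Qed.

Lemma Cm_on_pow (m : nat) (D : R * R -> Prop) (v : R -> R -> R) (j : nat) :
  open D -> Cm_on m D v -> Cm_on m D (fun x t => v x t ^ j).
Proof.
  intros HD Hv; induction j as [|j IH]; simpl.
  - now apply Cm_on_const.
  - now apply Cm_on_mult.
Qed.

Lemma smooth_Derive (g : R -> R) : smooth g -> smooth (Derive g).
Proof.
  intros Hg [|m] v; simpl; trivial.
  apply ex_derive_ext with (Derive_n g (m + 1)).
  - intros y; symmetry; exact (Derive_n_comp g m 1 y).
  - rewrite Nat.add_1_r; exact (Hg (S (S m)) v).
Qed.

(** The chain rule writes each partial derivative as a product with [dg (v x t)]. Keeping [dg]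
    separate serves two cases: an induction with [dg = Derive g] for smooth [g], and an
    antiderivative, whose derivative [f r ^ j] is explicit. *)
Lemma Cm_on_comp_of_derivative (m : nat) (D : R * R -> Prop) (g dg : R -> R)
    (v : R -> R -> R) :
  open D -> (forall r, is_derive g r (dg r)) ->
  Cm_on (S m) D v -> Cm_on m D (fun x t => dg (v x t)) ->
  Cm_on (S m) D (fun x t => g (v x t)).
Proof.
  intros HD Hg [Hc [He [Hx Ht]]] Hdg.
  assert (Hgx : forall x t, D (x, t) -> is_derive (fun y => g (v y t)) x
                 (Derive (fun y => v y t) x * dg (v x t))).
  { intros x t H; apply (is_derive_comp g (fun y => v y t)); [apply Hg|].
    apply Derive_correct; exact (proj1 (He x t H)). }
  assert (Hgt : forall x t, D (x, t) -> is_derive (fun s => g (v x s)) t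
                 (Derive (fun s => v x s) t * dg (v x t))).
  { intros x t H; apply (is_derive_comp g (fun s => v x s)); [apply Hg|].
    apply Derive_correct; exact (proj2 (He x t H)). }
  split; [|split; [intros x t H; split|split]].
  - intros x t H; apply continuity_1d_2d_pt_comp; [|now apply Hc].
    apply continuity_pt_filterlim.
    apply @ex_derive_continuous; eexists; apply Hg.
  - eexists; now apply Hgx.
  - eexists; now apply Hgt.
  - apply Cm_on_ext with (3 := Cm_on_mult _ _ _ _ HD Hx Hdg); trivial.
    intros x t H; symmetry; apply is_derive_unique; now apply Hgx.
  - apply Cm_on_ext with (3 := Cm_on_mult _ _ _ _ HD Ht Hdg); trivial.
    intros x t H; symmetry; apply is_derive_unique; now apply Hgt.
Qed.

Lemma Cm_on_comp (m : nat) (D : R * R -> Prop) (g : R -> R) (v : R -> R -> R) :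
  open D -> smooth g -> Cm_on m D v -> Cm_on m D (fun x t => g (v x t)).
Proof.
  intros HD; revert g; induction m as [|m IH]; intros g Hg Hv.
  - split; [|trivial]; intros x t H.
    apply continuity_1d_2d_pt_comp; [|now apply Hv].
    apply continuity_pt_filterlim.
    apply @ex_derive_continuous; exact (Hg 1%nat _).
  - apply Cm_on_comp_of_derivative with (Derive g); trivial.
    + intros r; apply Derive_correct; exact (Hg 1%nat r).
    + apply IH; [now apply smooth_Derive|now apply Cm_on_S].
Qed.

Lemma smooth_on_antiderivative (D : R * R -> Prop) (f : R -> R)
    (U : nat -> R -> R) (u : R -> R -> R) (j : nat) :
  smooth f -> antiderivatives_of_powers f U -> open D -> smooth_on D u ->
  smooth_on D (fun x t => U j (u x t)).
Proof.
  (* Raising the goal to order [S m] gives it the form of the composition lemma, which then asks for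
     order [m] of [f(u)^j] only. *)
  intros Hf [_ HU] HD Hu m; apply Cm_on_S.
  apply (Cm_on_comp_of_derivative m D (U j) (fun r => f r ^ j)); trivial.
  now apply Cm_on_pow; [|apply Cm_on_comp].
Qed.

(** * Partial derivatives of smooth functions and their commutation *)

Lemma smooth_on_ex_derive (D : R * R -> Prop) (v : R -> R -> R) (x t : R) :
  smooth_on D v -> D (x, t) ->
  ex_derive (fun y => v y t) x /\ ex_derive (fun s => v x s) t.
Proof. intros Hv; now apply (Hv 1%nat). Qed.

Lemma smooth_on_Derive_x (D : R * R -> Prop) (v : R -> R -> R) :
  smooth_on D v -> smooth_on D (fun x t => Derive (fun y => v y t) x).
Proof. intros Hv m; apply (Hv (S m)). Qed.

Lemma smooth_on_Derive_t (D : R * R -> Prop) (v : R -> R -> R) :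
  smooth_on D v -> smooth_on D (fun x t => Derive (fun s => v x s) t).
Proof. intros Hv m; apply (Hv (S m)). Qed.

Lemma smooth_on_Derive_n_x (D : R * R -> Prop) (v : R -> R -> R) (j : nat) :
  smooth_on D v -> smooth_on D (fun x t => Derive_n (fun y => v y t) j x).
Proof.
  intros Hv; induction j as [|j IH]; simpl; trivial.
  exact (smooth_on_Derive_x _ _ IH).
Qed.

Lemma smooth_on_Derive_n_t (D : R * R -> Prop) (v : R -> R -> R) (j : nat) :
  smooth_on D v -> smooth_on D (fun x t => Derive_n (fun s => v x s) j t).
Proof.
  intros Hv; induction j as [|j IH]; simpl; trivial.
  exact (smooth_on_Derive_t _ _ IH).
Qed.

Lemma smooth_on_ex_derive_n_x (D : R * R -> Prop) (v : R -> R -> R)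
    (j : nat) (x t : R) :
  smooth_on D v -> D (x, t) -> ex_derive_n (fun y => v y t) j x.
Proof.
  intros Hv H; destruct j as [|j]; simpl; trivial.
  exact (proj1 (smooth_on_ex_derive _ _ _ _ (smooth_on_Derive_n_x D v j Hv) H)).
Qed.

Lemma smooth_on_Schwarz (D : R * R -> Prop) (v : R -> R -> R) (x t : R) :
  open D -> smooth_on D v -> D (x, t) ->
  Derive (fun s => Derive (fun y => v y s) x) t =
  Derive (fun y => Derive (fun s => v y s) t) x.
Proof.
  intros HD Hv H; symmetry.
  pose proof (smooth_on_Derive_x _ _ Hv) as Hx.
  pose proof (smooth_on_Derive_t _ _ Hv) as Ht.
  apply (Schwarz v x t).
  - apply locally_2d_impl with (2 := locally_2d_open D x t HD H).
    apply locally_2d_forall; intros y s H'.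
    repeat split.
    + exact (proj1 (smooth_on_ex_derive _ _ _ _ Hv H')).
    + exact (proj2 (smooth_on_ex_derive _ _ _ _ Hv H')).
    + exact (proj1 (smooth_on_ex_derive _ _ _ _ Ht H')).
    + exact (proj2 (smooth_on_ex_derive _ _ _ _ Hx H')).
  - exact (proj1 (smooth_on_Derive_x _ _ Ht 0%nat) x t H).
  - exact (proj1 (smooth_on_Derive_t _ _ Hx 0%nat) x t H).
Qed.

(** The t-derivative moves past one x-derivative at a time: Schwarz applies to the [j]-th
    x-derivative, itself smooth, and the induction hypothesis, valid on a whole x-slice near the
    point, may be differentiated in [x]. *)
Lemma Derive_t_Derive_n_x (D : R * R -> Prop) (v : R -> R -> R)
    (j : nat) (x t : R) :
  open D -> smooth_on D v -> D (x, t) ->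
  Derive (fun s => Derive_n (fun y => v y s) j x) t =
  Derive_n (fun y => Derive (fun s => v y s) t) j x.
Proof.
  intros HD Hv; revert x t; induction j as [|j IH]; intros x t H; trivial.
  simpl.
  etransitivity.
  - exact (smooth_on_Schwarz D _ x t HD (smooth_on_Derive_n_x D v j Hv) H).
  - apply Derive_ext_loc.
    apply (filter_imp (fun y => D (y, t))); [intros y; apply IH|].
    now apply locally_slice_x.
Qed.

(** * Time derivatives of a solution *)

Section Solution.

Variables (f : R -> R) (U : nat -> R -> R) (D : R * R -> Prop).
Variable u : R -> R -> R.
Hypothesis Hf : smooth f.
Hypothesis HU : antiderivatives_of_powers f U.
Hypothesis HD : open D.
Hypothesis Hu : smooth_on D u.
Hypothesis Hpde : advection_solution_on D f u.

(** Each [U j (u)] is a density with flux [U (S j) (u)]: both sides equal [f(u)^(j+1)] times the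
    x-derivative of [u]. *)
Lemma conservation_law (j : nat) (x t : R) : D (x, t) ->
  Derive (fun s => U j (u x s)) t = Derive (fun y => U (S j) (u y t)) x.
Proof.
  intros H.
  destruct (smooth_on_ex_derive _ _ _ _ Hu H) as [Hx Ht].
  destruct HU as [_ HU'].
  assert (Et : Derive (fun s => U j (u x s)) t =
               Derive (fun s => u x s) t * f (u x t) ^ j).
  { apply is_derive_unique, (is_derive_comp (U j) (fun s => u x s));
      [apply HU'|now apply Derive_correct]. }
  assert (Ex : Derive (fun y => U (S j) (u y t)) x =
               Derive (fun y => u y t) x * f (u x t) ^ S j).
  { apply is_derive_unique, (is_derive_comp (U (S j)) (fun y => u y t));
      [apply HU'|now apply Derive_correct]. }
  rewrite Et, Ex, Hpde; trivial; simpl; ring.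
Qed.

Lemma Derive_n_t_solution (j : nat) (x t : R) : D (x, t) ->
  Derive_n (fun s => u x s) j t = Derive_n (fun y => U j (u y t)) j x.
Proof.
  revert x t; induction j as [|j IH]; intros x t H.
  { simpl; symmetry; apply (proj1 HU). }
  simpl; transitivity (Derive (fun s => Derive_n (fun y => U j (u y s)) j x) t).
  (* The induction hypothesis holds along the t-slice through the point, hence can be differentiated
     in [t]. *)
  { apply Derive_ext_loc.
    apply (filter_imp (fun s => D (x, s))); [intros s; apply IH|].
    now apply locally_slice_t. }
  rewrite (Derive_t_Derive_n_x D (fun y s => U j (u y s)) j x t HD); trivial.
  2: { now apply smooth_on_antiderivative with f. }
  rewrite (Derive_n_ext_loc _ (Derive (fun y => U (S j) (u y t)))).
  - etransitivity; [exact (Derive_n_comp _ j 1 x)|].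
    now rewrite Nat.add_1_r.
  - apply (filter_imp (fun y => D (y, t))).
    + intros y; apply conservation_law.
    + now apply locally_slice_x.
Qed.

(** An equality between values of the total [Derive_n] does not give existence; differentiability of
    the lower t-derivatives comes from the smoothness of [u]. *)
Lemma is_derive_n_t_solution (j : nat) (x t : R) : D (x, t) ->
  is_derive_n (fun s => u x s) j t (Derive_n (fun y => U j (u y t)) j x).
Proof.
  intros H; rewrite <- Derive_n_t_solution; trivial.
  destruct j as [|j]; simpl; trivial.
  apply Derive_correct.
  exact (proj2 (smooth_on_ex_derive _ _ _ _ (smooth_on_Derive_n_t D u j Hu) H)).
Qed.

End Solution.

(** * Polynomials of bounded degree *)

(* Horner form: [p x = c + x * q x] with [q] of degree at most [n - 1]. *)
Fixpoint poly_le (n : nat) (p : R -> R) : Prop :=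
  match n with
  | O => exists c, forall x, p x = c
  | S m => exists c q, poly_le m q /\ forall x, p x = c + x * q x
  end.

Lemma poly_le_ext (n : nat) (p q : R -> R) :
  (forall x, p x = q x) -> poly_le n p -> poly_le n q.
Proof.
  intros E; destruct n as [|n]; simpl.
  - intros [c Hc]; exists c; intros x; now rewrite <- E.
  - intros [c [r [Hr H]]]; exists c, r; split; trivial.
    intros x; now rewrite <- E.
Qed.

Lemma poly_le_const (n : nat) (c : R) : poly_le n (fun _ => c).
Proof.
  revert c; induction n as [|n IH]; intros c; simpl.
  - now exists c.
  - exists c, (fun _ => 0); split; [apply IH|intros; ring].
Qed.

Lemma poly_le_plus (n : nat) (p q : R -> R) :
  poly_le n p -> poly_le n q -> poly_le n (fun x => p x + q x).
Proof.
  revert p q; induction n as [|n IH]; intros p q; simpl.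
  - intros [c Hc] [d Hd]; exists (c + d); intros x; now rewrite Hc, Hd.
  - intros [c [p' [Hp Ep]]] [d [q' [Hq Eq]]].
    exists (c + d), (fun x => p' x + q' x); split; [now apply IH|].
    intros x; rewrite Ep, Eq; ring.
Qed.

Lemma poly_le_scal (n : nat) (p : R -> R) (a : R) :
  poly_le n p -> poly_le n (fun x => a * p x).
Proof.
  revert p; induction n as [|n IH]; intros p; simpl.
  - intros [c Hc]; exists (a * c); intros x; now rewrite Hc.
  - intros [c [q [Hq E]]].
    exists (a * c), (fun x => a * q x); split; [now apply IH|].
    intros x; rewrite E; ring.
Qed.

Lemma poly_le_S (n : nat) (p : R -> R) : poly_le n p -> poly_le (S n) p.
Proof.
  revert p; induction n as [|n IH]; intros p.
  - intros [c Hc]; exists c, (fun _ => 0); split; [apply poly_le_const|].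
    intros x; rewrite Hc; ring.
  - intros [c [q [Hq E]]]; exists c, q; split; [now apply IH|exact E].
Qed.

Lemma poly_le_mul_X (n : nat) (p : R -> R) :
  poly_le n p -> poly_le (S n) (fun x => x * p x).
Proof. intros Hp; exists 0, p; split; [exact Hp|intros; ring]. Qed.

Lemma poly_le_pow (n l : nat) : (l <= n)%nat -> poly_le n (fun x => x ^ l).
Proof.
  revert l; induction n as [|n IH]; intros [|l] Hl; try lia.
  - exact (poly_le_const 0 1).
  - exact (poly_le_const (S n) 1).
  - simpl; apply poly_le_mul_X, IH; lia.
Qed.

Lemma poly_le_sum (n m : nat) (p : nat -> R -> R) :
  (forall i, (i <= m)%nat -> poly_le n (p i)) ->
  poly_le n (fun x => sum_f_R0 (fun i => p i x) m).
Proof.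
  induction m as [|m IH]; intros Hp; simpl; [now apply Hp|].
  apply poly_le_plus; [apply IH; intros; apply Hp; lia|now apply Hp].
Qed.

(** Factor theorem in Horner form: if [p x = c + x * q x] and [q x = q a + (x - a) * r x], then
    [p x - p a = (x - a) * (q a + x * r x)]. *)
Lemma poly_le_factor (n : nat) (p : R -> R) (a : R) : poly_le (S n) p ->
  exists q, poly_le n q /\ forall x, p x = p a + (x - a) * q x.
Proof.
  revert p; induction n as [|n IH]; intros p [c [q [Hq E]]].
  - exists q; split; trivial.
    destruct Hq as [d Hd]; intros x; rewrite !E, !Hd; ring.
  - destruct (IH q Hq) as [r [Hr Er]].
    exists (fun x => q a + x * r x); split.
    + now exists (q a), r.
    + intros x; rewrite !E, (Er x); ring.
Qed.

(** Splitting off the root [k (S n)] leaves a quotient of degree at most [n] that vanishes at the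
    other [n + 1] nodes, since [k i - k (S n)] is nonzero there. *)
Lemma poly_le_eq0 (n : nat) (k : nat -> R) (p : R -> R) : poly_le n p ->
  (forall i j, (i <= n)%nat -> (j <= n)%nat -> k i = k j -> i = j) ->
  (forall i, (i <= n)%nat -> p (k i) = 0) -> forall x, p x = 0.
Proof.
  revert p; induction n as [|n IH]; intros p Hp Hk Hr x.
  - destruct Hp as [c Hc]; rewrite Hc, <- (Hc (k 0%nat)); now apply Hr.
  - destruct (poly_le_factor n p (k (S n)) Hp) as [q [Hq E]].
    rewrite E, Hr, (IH q Hq); [ring| |  |lia].
    + intros i j Hi Hj; apply Hk; lia.
    + intros i Hi.
      pose proof (E (k i)) as Ei; rewrite !Hr in Ei by lia.
      destruct (Rmult_integral (k i - k (S n)) (q (k i))) as [H|H]; [lra| |easy].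
      assert (i = S n) by (apply Hk; lia || lra); lia.
Qed.

(** From [p = c + x q] comes [p' = q + x q']. Keeping the same bound [n] for [p'] is enough to
    iterate the lemma over higher derivatives. *)
Lemma poly_le_Derive (n : nat) (p : R -> R) :
  poly_le n p -> (forall x, ex_derive p x) /\ poly_le n (Derive p).
Proof.
  revert p; induction n as [|n IH]; intros p.
  - intros [c Hc].
    assert (Hd : forall x, is_derive p x 0).
    { intros x; apply is_derive_ext with (fun _ => c); [now intros; rewrite Hc|].
      apply @is_derive_const. }
    split; [intros x; eexists; apply Hd|].
    exists 0; intros x; apply is_derive_unique, Hd.
  - intros [c [q [Hq E]]].
    destruct (IH q Hq) as [Hex Hdq].
    assert (Hd : forall x, is_derive p x (q x + x * Derive q x)).
    { intros x; apply is_derive_ext with (fun x => c + x * q x);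
        [now intros; rewrite E|].
      auto_derive; [apply Hex|]; change (fun y => q y) with q; ring. }
    split; [intros x; eexists; apply Hd|].
    apply poly_le_ext with (fun x => q x + x * Derive q x).
    + intros x; symmetry; apply is_derive_unique, Hd.
    + apply poly_le_plus; [now apply poly_le_S|now apply poly_le_mul_X].
Qed.

Lemma poly_le_ex_derive_n (n : nat) (p : R -> R) (j : nat) (x : R) :
  poly_le n p -> ex_derive_n p j x.
Proof.
  intros Hp.
  assert (H : forall m, poly_le n (Derive_n p m)).
  { induction m as [|m IH]; simpl; [exact Hp|now apply poly_le_Derive]. }
  destruct j as [|j]; simpl; trivial.
  now apply (poly_le_Derive n _ (H j)).
Qed.

(** * Lagrange interpolation and the moment conditions *)

Lemma lagrange_poly_le (n : nat) (k : nat -> Z) (i : nat) :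
  (i <= n)%nat -> poly_le n (lagrange n k i).
Proof.
  intros Hi.
  (* the factor of index [i] is [1], so it does not raise the degree *)
  assert (H : forall m, poly_le (if Nat.leb i m then m else S m) (fun x =>
    prod_f_R0 (fun j => if Nat.eqb j i then 1
       else (x - IZR (k j)) / (IZR (k i) - IZR (k j))) m)).
  { assert (Hlin : forall (d : nat) (p : R -> R) (a b : R), poly_le d p ->
        poly_le (S d) (fun x => p x * ((x - a) / b))).
    { intros d p a b Hp.
      apply poly_le_ext with (fun x => / b * (x * p x) + (- (a / b)) * p x).
      - intros x; unfold Rdiv; ring.
      - apply poly_le_plus; apply poly_le_scal;
          [now apply poly_le_mul_X|now apply poly_le_S]. }
    induction m as [|m IH]; cbn [prod_f_R0].
    - destruct i as [|i]; [exact (poly_le_const 0 1)|].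
      apply poly_le_ext with (2 := Hlin 0%nat (fun _ => 1) (IZR (k 0%nat))
        (IZR (k (S i)) - IZR (k 0%nat)) (poly_le_const 0 1)).
      intros x; cbn [Nat.eqb]; ring.
    - destruct (Nat.eqb_spec (S m) i) as [Hm|Hm].
      (* The new factor is the trivial one. The bound is [S m] on both sides: for [m] because [i]
         has not been reached, for [S m] because it has. *)
      + replace (Nat.leb i (S m)) with true by (symmetry; apply Nat.leb_le; lia).
        replace (Nat.leb i m) with false in IH
          by (symmetry; apply Nat.leb_gt; lia).
        apply poly_le_ext with (2 := IH); intros x; ring.
      + destruct (Nat.leb_spec i (S m)) as [Hl|Hl];
          destruct (Nat.leb_spec i m) as [Hl'|Hl']; try lia; now apply Hlin. }
  specialize (H n).
  replace (Nat.leb i n) with true in H by (symmetry; now apply Nat.leb_le).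
  exact H.
Qed.

Lemma prod_f_R0_eq0 (F : nat -> R) (m j : nat) :
  (j <= m)%nat -> F j = 0 -> prod_f_R0 F m = 0.
Proof.
  induction m as [|m IH]; intros Hj H; simpl.
  - now replace j with 0%nat in H by lia.
  - destruct (Nat.eq_dec j (S m)) as [->|Hne]; [rewrite H; ring|].
    rewrite IH; [ring|lia|exact H].
Qed.

Lemma prod_f_R0_eq1 (F : nat -> R) (m : nat) :
  (forall j, (j <= m)%nat -> F j = 1) -> prod_f_R0 F m = 1.
Proof.
  induction m as [|m IH]; intros H; simpl; [now apply H|].
  rewrite IH, H; [ring|lia|intros; apply H; lia].
Qed.

Lemma lagrange_node (n : nat) (k : nat -> Z) (i m : nat) :
  distinct_nodes n k -> (i <= n)%nat -> (m <= n)%nat ->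
  lagrange n k i (IZR (k m)) = if Nat.eqb i m then 1 else 0.
Proof.
  intros Hk Hi Hm; unfold lagrange.
  destruct (Nat.eqb_spec i m) as [->|Hne].
  - apply prod_f_R0_eq1; intros j Hj.
    destruct (Nat.eqb_spec j m) as [|Hjm]; trivial.
    (* The denominator is nonzero because equal real nodes would be equal integers, against
       distinctness. *)
    apply Rdiv_diag; intros E; apply Hjm, Hk; trivial.
    apply eq_IZR; lra.
  (* The factor of index [m] has numerator [k m - k m]. *)
  - apply prod_f_R0_eq0 with m; trivial.
    replace (Nat.eqb m i) with false by (symmetry; apply Nat.eqb_neq; lia).
    unfold Rdiv; ring.
Qed.

Lemma sum_f_R0_single (F : nat -> R) (n m : nat) : (m <= n)%nat ->
  (forall i, (i <= n)%nat -> i <> m -> F i = 0) -> sum_f_R0 F n = F m.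
Proof.
  induction n as [|n IH]; intros Hm H; simpl.
  - now replace m with 0%nat by lia.
  - destruct (Nat.eq_dec m (S n)) as [->|Hne].
    + rewrite (sum_eq _ (fun _ => 0)) by (intros; apply H; lia).
      rewrite sum_cte; ring.
    + rewrite IH, (H (S n)); [ring|lia|lia|lia|intros; apply H; lia].
Qed.

Lemma lagrange_interpolates_pow (n : nat) (k : nat -> Z) (l : nat) (x : R) :
  distinct_nodes n k -> (l <= n)%nat ->
  sum_f_R0 (fun i => IZR (k i) ^ l * lagrange n k i x) n = x ^ l.
Proof.
  intros Hk Hl; apply Rminus_diag_uniq.
  apply (poly_le_eq0 n (fun i => IZR (k i)) (fun x =>
    sum_f_R0 (fun i => IZR (k i) ^ l * lagrange n k i x) n - x ^ l)).
  - apply poly_le_ext with (fun x =>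
      sum_f_R0 (fun i => IZR (k i) ^ l * lagrange n k i x) n + -1 * x ^ l).
    { intros y; ring. }
    apply poly_le_plus; [|now apply poly_le_scal, poly_le_pow].
    apply poly_le_sum; intros i Hi; now apply poly_le_scal, lagrange_poly_le.
  - intros i j Hi Hj E; apply Hk; trivial; now apply eq_IZR.
  (* At the node [k m] only the term [i = m] survives, with value [(k m)^l]. *)
  - intros m Hm; rewrite (sum_f_R0_single _ n m); trivial.
    + rewrite lagrange_node, Nat.eqb_refl; trivial; ring.
    + intros i Hi Him; rewrite lagrange_node; trivial.
      rewrite (proj2 (Nat.eqb_neq i m) Him); ring.
Qed.

Lemma lagrange_derivative_moments (n : nat) (k : nat -> Z) (j l : nat) :
  distinct_nodes n k -> (l <= n)%nat ->
  sum_f_R0 (fun i => IZR (k i) ^ l * Derive_n (lagrange n k i) j 0) n =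
  if Nat.eqb l j then INR (fact j) else 0.
Proof.
  intros Hk Hl.
  transitivity (Derive_n (fun x => x ^ l) j 0).
  - rewrite <- (Derive_n_ext (fun x =>
      sum_n (fun i => IZR (k i) ^ l * lagrange n k i x) n)).
    2: { intros x; rewrite sum_n_Reals; now apply lagrange_interpolates_pow. }
    rewrite Derive_n_sum_n.
    + rewrite sum_n_Reals; apply sum_eq; intros i _.
      now rewrite Derive_n_scal_l.
    + apply filter_forall; intros x i m Hi _.
      apply poly_le_ex_derive_n with n.
      now apply poly_le_scal, lagrange_poly_le.
  (* At [0] the [j]-th derivative of [x^l] is [l!] for [l = j], keeps a positive power of [0] for
     [j < l], and vanishes identically for [l < j]. *)
  - destruct (Nat.eqb_spec l j) as [<-|Hne].
    + rewrite Derive_n_pow_smalli, Nat.sub_diag by lia; simpl; field.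
    + destruct (le_lt_dec j l) as [Hjl|Hjl].
      * rewrite Derive_n_pow_smalli by trivial.
        rewrite pow_ne_zero by lia; ring.
      * now apply Derive_n_pow_bigi.
Qed.

Lemma scheme_coef_moments (n : nat) (k : nat -> Z) (nu : R) (j l : nat) :
  distinct_nodes n k -> (l <= n)%nat ->
  sum_f_R0 (fun i => scheme_coef n k nu j i * IZR (k i) ^ l) n =
  if Nat.eqb l j then nu ^ j else 0.
Proof.
  intros Hk Hl.
  rewrite (sum_eq _ (fun i =>
    (IZR (k i) ^ l * Derive_n (lagrange n k i) j 0) * (nu ^ j / INR (fact j)))).
  2: { intros i _; unfold scheme_coef; ring. }
  rewrite <- scal_sum, lagrange_derivative_moments; trivial.
  destruct (Nat.eqb l j); [field; apply INR_fact_neq_0|ring].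
Qed.

(** * Expansion of the scheme *)

Lemma sum_f_R0_switch (F : nat -> nat -> R) (m n : nat) :
  sum_f_R0 (fun i => sum_f_R0 (F i) n) m =
  sum_f_R0 (fun j => sum_f_R0 (fun i => F i j) m) n.
Proof.
  rewrite <- !sum_n_Reals.
  etransitivity; [apply sum_n_ext; intros; symmetry; apply sum_n_Reals|].
  rewrite sum_n_switch.
  apply sum_n_ext; intros; apply sum_n_Reals.
Qed.

(** The algebra of the order condition, with [a j l] standing for the [l]-th Taylor coefficient of
    [U j (u)] in space. Exchanging the sums over nodes and powers exposes the moments of the
    coefficients, which keep only [l = j]; there [(dt / dx)^j * dx^j = dt^j]. *)
Lemma scheme_rhs_polynomial (n : nat) (k : nat -> Z) (dt dx : R)
    (a : nat -> nat -> R) :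
  distinct_nodes n k -> dx <> 0 ->
  scheme_rhs n k (dt / dx)
    (fun j i => sum_f_R0 (fun l => a j l * (IZR (k i) * dx) ^ l) n) =
  sum_f_R0 (fun j => dt ^ j * a j j) n.
Proof.
  intros Hk Hdx; apply sum_eq; intros j Hj.
  rewrite (sum_eq _ (fun i => sum_f_R0 (fun l =>
    scheme_coef n k (dt / dx) j i * IZR (k i) ^ l * (a j l * dx ^ l)) n)).
  2: { intros i _; rewrite scal_sum; apply sum_eq; intros l _.
       rewrite Rpow_mult_distr; ring. }
  rewrite sum_f_R0_switch.
  rewrite (sum_eq _ (fun l =>
    a j l * dx ^ l * (if Nat.eqb l j then (dt / dx) ^ j else 0))).
  2: { intros l Hl; rewrite <- (scheme_coef_moments n k (dt / dx) j l Hk Hl).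
       now rewrite scal_sum. }
  rewrite (sum_f_R0_single _ n j Hj).
  - rewrite Nat.eqb_refl; unfold Rdiv; rewrite Rpow_mult_distr, pow_inv.
    field; now apply pow_nonzero.
  - intros l _ Hl; rewrite (proj2 (Nat.eqb_neq l j) Hl); ring.
Qed.

Lemma Derive_n_comp_affine (w : R -> R) (x a : R) (l : nat) :
  locally x (fun y => forall m, (m <= l)%nat -> ex_derive_n w m y) ->
  Derive_n (fun h => w (x + a * h)) l 0 = a ^ l * Derive_n w l x.
Proof.
  intros Hw.
  (* The affine map is a scaling followed by a translation, each with its own rule. A node [a = 0]
     is covered, with [0^0 = 1] at [l = 0]. *)
  transitivity (Derive_n (fun h => (fun y => w (y + x)) (a * h)) l 0).
  { apply Derive_n_ext; intros h; f_equal; ring. }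
  etransitivity; [apply (Derive_n_comp_scal (fun y => w (y + x)))|].
  - rewrite Rmult_0_r.
    (* The radius around [x] serves around [0], since [y + x] is as far from [x] as [y] is from
       [0]. *)
    destruct Hw as [eps Heps]; exists eps; intros y Hy m Hm.
    apply ex_derive_n_comp_trans, Heps; trivial.
    revert Hy; unfold ball; simpl; unfold AbsRing_ball, abs, minus, plus, opp;
      simpl.
    now replace (y + x + - x) with (y + - 0) by ring.
  - rewrite Derive_n_comp_trans; do 2 f_equal; ring.
Qed.

(** Expansions are formal: each sample enters as its Taylor polynomial in the spacing at fixed [x],
    so only the base point [(x, 0)], and not the shifted sample points, is asked to lie in [D]. *)
Theorem mainTheorem7
  (f : R -> R) (U : nat -> R -> R) (D : R * R -> Prop) (u : R -> R -> R)
  (Hf : smooth f)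
  (HU : antiderivatives_of_powers f U)
  (HD : open D)
  (Hu : smooth_on D u)
  (Hpde : advection_solution_on D f u) :
  (forall (j : nat) (x t : R), (1 <= j)%nat -> D (x, t) ->
     ex_derive_n (fun y => U j (u y t)) j x /\
     is_derive_n (fun s => u x s) j t
       (Derive_n (fun y => U j (u y t)) j x)) /\
  (forall (x : R), D (x, 0) -> forall j : nat,
     taylor_coef (fun s => u x s) 0 j =
     Derive_n (fun y => U j (u y 0)) j x / INR (fact j)) /\
  (forall (n : nat) (k : nat -> Z) (dt dx : R),
     (1 <= n)%nat -> distinct_nodes n k -> 0 < dt -> 0 < dx ->
     (forall j l : nat, (j <= n)%nat -> (l <= n)%nat ->
        sum_f_R0 (fun i => scheme_coef n k (dt / dx) j i * IZR (k i) ^ l) n =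
        if Nat.eqb l j then (dt / dx) ^ j else 0) /\
     (forall x : R, D (x, 0) ->
        scheme_rhs n k (dt / dx)
          (fun j i => taylor_poly n (fun h => U j (u (x + IZR (k i) * h) 0)) dx)
        = sum_f_R0 (fun j => dt ^ j / INR (fact j) *
                       Derive_n (fun y => U j (u y 0)) j x) n /\
        scheme_rhs n k (dt / dx)
          (fun j i => taylor_poly n (fun h => U j (u (x + IZR (k i) * h) 0)) dx)
        = taylor_poly n (fun s => u x s) dt)).
Proof.
  assert (Hw : forall j, smooth_on D (fun x t => U j (u x t))).
  { intros j; now apply smooth_on_antiderivative with f. }
  split; [|split].
  - intros j x t _ H; split.
    + exact (smooth_on_ex_derive_n_x D (fun y s => U j (u y s)) j x t (Hw j) H).
    + now apply is_derive_n_t_solution with f D.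
  - intros x H j; unfold taylor_coef.
    now rewrite (Derive_n_t_solution f U D u).
  - intros n k dt dx _ Hk _ Hdx; split.
    { intros j l _ Hl; now apply scheme_coef_moments. }
    intros x H.
    assert (E : scheme_rhs n k (dt / dx)
          (fun j i => taylor_poly n (fun h => U j (u (x + IZR (k i) * h) 0)) dx)
        = sum_f_R0 (fun j => dt ^ j / INR (fact j) *
                       Derive_n (fun y => U j (u y 0)) j x) n).
    (* The factor [k_i^l] produced by differentiating [h] inside [x + k_i h] joins [dx^l], which
       gives the data the polynomial form of [scheme_rhs_polynomial]. *)
    { transitivity (scheme_rhs n k (dt / dx) (fun j i => sum_f_R0 (fun l =>
        (Derive_n (fun y => U j (u y 0)) l x / INR (fact l)) *
          (IZR (k i) * dx) ^ l) n)).
      - apply sum_eq; intros j _; apply sum_eq; intros i _; f_equal.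
        apply sum_eq; intros l _; unfold taylor_coef.
        rewrite (Derive_n_comp_affine (fun y => U j (u y 0)) x (IZR (k i)) l).
        + rewrite Rpow_mult_distr; field; apply INR_fact_neq_0.
        + apply (filter_imp (fun y => D (y, 0)));
            [|now apply locally_slice_x].
          intros y Hy m _.
          exact (smooth_on_ex_derive_n_x D (fun y s => U j (u y s)) m y 0
                   (Hw j) Hy).
      - rewrite scheme_rhs_polynomial; [|exact Hk|lra].
        apply sum_eq; intros j _; field; apply INR_fact_neq_0. }
    split; [exact E|rewrite E].
    (* Termwise, the [j]-th x-derivative of [U j (u)] is the [j]-th t-derivative of [u] at time
       [0]. *)
    apply sum_eq; intros j _; unfold taylor_coef.
    rewrite (Derive_n_t_solution f U D u); trivial.
    field; apply INR_fact_neq_0.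
Qed.
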